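(* For any state $q\in\mathbb{R}_+^{\mathbb{J}}$, there exists $\tau=\tau(q)\in\mathbb{R}_+$ (with $\mathbb{I}_\tau\neq\emptyset$) such that the linear program $$(P_{q,\tau})\qquad \max\ w_\tau\cdot\nu\quad\text{s.t.}\quad \nu A_{\tau,q}\le\lambda_q,\ \ \nu\ge 0,\qquad \nu\in\mathbb{R}^{\mathbb{I}_\tau},$$ has an optimal solution $\nu$ that can be extended (by setting it to $0$ on $\mathbb{I}\setminus\mathbb{I}_\tau$) to an admissible schedule at state $q$; namely, $\|\nu\|_1=1$.
   Context: Fix an integer $n\ge 1$; $[n]=\{1,\dots,n\}$ and $\mathbb{J}=[n]\times[n]$ is the set of queues. The set of basic schedules is $\mathbb{I}=\{s\in\{0,1\}^{\mathbb{J}}:\sum_{i}s(i,j)\le 1\ \forall j,\ \sum_{j}s(i,j)\le 1\ \forall i\}$ (the zero schedule is included). Write $\rho\in s$ if $s(\rho)=1$. The matrix $A\in\{0,1\}^{\mathbb{I}\times\mathbb{J}}$ is $A(s,\rho)=s(\rho)$, and $(\mu A)(\rho)=\sum_{s}\mu(s)A(s,\rho)$. $\|\cdot\|_1$ is the 1-norm. $c\in(0,\infty)^{\mathbb{J}}$ is the vector of cost coefficients, $w(s)=\sum_{\rho\in s}c(\rho)$ is the weight of $s\in\mathbb{I}$, and $\lambda\in[0,1]^{\mathbb{J}}$ is the arrival rate vector. For $q\in\mathbb{R}_+^{\mathbb{J}}$ and $\tau\in\mathbb{R}_+$: $\mathbb{I}_\tau=\{s\in\mathbb{I}:w(s)\ge\tau\}$,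 $\mathbb{J}_q=\{\rho\in\mathbb{J}:q(\rho)=0\}$, $w_\tau=[w(s)-\tau:s\in\mathbb{I}_\tau]$, $A_{\tau,q}=[A(s,\rho):s\in\mathbb{I}_\tau,\rho\in\mathbb{J}_q]$, $\lambda_q=[\lambda(\rho):\rho\in\mathbb{J}_q]$. The program $(P_{q,\tau})$ is formulated for $\tau$ with $\mathbb{I}_\tau\ne\emptyset$. A schedule is a vector $\mu\in[0,1]^{\mathbb{I}}$ with $\|\mu\|_1=1$; it is admissible at $q$ if $(\mu A)(\rho)\le\lambda(\rho)$ for every $\rho$ with $q(\rho)=0$. (A $\tau$ as in the claim is called a critical threshold of $q$.) *)

(* Defs.v *)
From HB Require Import structures.
From mathcomp Require Import all_boot all_order all_algebra.
From mathcomp Require Import reals.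

Set Implicit Arguments.
Unset Strict Implicit.
Unset Printing Implicit Defensive.

Import Order.TTheory GRing.Theory Num.Theory.
Local Open Scope ring_scope.

Definition queue (n : nat) : finType := ('I_n * 'I_n)%type.

(* 0/1 vectors are boolean-valued; the sums below count in nat. *)
Definition is_basic (n : nat) (s : {ffun queue n -> bool}) : bool :=
  [forall j : 'I_n, (\sum_(i < n) s (i, j) <= 1)%N] &&
  [forall i : 'I_n, (\sum_(j < n) s (i, j) <= 1)%N].

Definition basic (n : nat) : finType := {s : {ffun queue n -> bool} | is_basic s}.

Definition incidence (R : realType) (n : nat) (s : basic n) (rho : queue n) : R :=
  (val s rho)%:R.

Definition load (R : realType) (n : nat) (mu : {ffun basic n -> R})
    (rho : queue n) : R :=
  \sum_s mu s * incidence R s rho.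

Definition norm1 (R : realType) (T : finType) (x : {ffun T -> R}) : R :=
  \sum_t `|x t|.

Definition weight (R : realType) (n : nat) (c : {ffun queue n -> R})
    (s : basic n) : R :=
  \sum_(rho | val s rho) c rho.

Definition heavy (R : realType) (n : nat) (c : {ffun queue n -> R}) (tau : R) :
    finType :=
  {s : basic n | tau <= weight c s}.

Definition empty_queue (R : realType) (n : nat) (q : {ffun queue n -> R}) :
    finType :=
  {rho : queue n | q rho == 0}.

Definition schedule (R : realType) (n : nat) (mu : {ffun basic n -> R}) : Prop :=
  (forall s, 0 <= mu s <= 1) /\ norm1 mu = 1.

Definition admissible (R : realType) (n : nat) (lambda q : {ffun queue n -> R})
    (mu : {ffun basic n -> R}) : Prop :=
  forall rho, q rho = 0 -> load mu rho <= lambda rho.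

Section LinearProgram.

Variables (R : realType) (n : nat) (c lambda q : {ffun queue n -> R}) (tau : R).

Implicit Type nu : {ffun heavy c tau -> R}.

Definition objective nu : R := \sum_s (weight c (val s) - tau) * nu s.

Definition feasible nu : Prop :=
  (forall rho : empty_queue q,
     \sum_s nu s * incidence R (val s) (val rho) <= lambda (val rho)) /\
  (forall s, 0 <= nu s).

Definition optimal nu : Prop :=
  feasible nu /\ (forall nu', feasible nu' -> objective nu' <= objective nu).

Definition extend nu : {ffun basic n -> R} :=
  [ffun s => if insub s is Some t then nu t else 0].

End LinearProgram.

(* Main.v *)
Require Import Defs.
From mathcomp Require Import all_boot all_order all_algebra.
From mathcomp Require Import reals.
From mathcomp Require Import ring lra.
From mathcomp Require Import boolp classical_sets topology normedtype derive.

Import Order.TTheory GRing.Theory Num.Theory.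
Import numFieldNormedType.Exports.
Local Open Scope ring_scope.

(** The threshold is the Lagrange multiplier of the normalization constraint.
    Among the admissible schedules a heaviest one, [mu], exists by compactness
    ([polytope_max]).  Now drop the constraint that the total mass is 1: the
    pairs (total mass, total weight) of nonnegative admissible measures form a
    convex set in the plane whose highest point above abscissa 1 is the pair
    (1, V) of [mu].  Some line through (1, V) lies above the whole set
    ([supporting_line]); its slope is [tau].  Hence [mu] maximizes the total of
    [weight - tau] over all admissible measures, whatever their mass
    ([critical_multiplier]).

    Two perturbations of [mu] finish the proof.  Mass can be added to the idle
    schedule, which loads no queue and weighs nothing, so [tau] is nonnegative.
    Removing the mass of a schedule keeps the measure admissible, so by
    maximality [mu] charges no schedule of weight below [tau]
    ([maximizer_support]).  Therefore [mu] is the extension by zero of its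
    restriction to the heavy schedules.  That restriction is optimal for the
    program, since feasible points of the program are exactly the measures on
    heavy schedules whose extension is admissible, with the same objective
    value ([extend_feasible], [objective_extend]). *)

(** * Convex and compact sets *)

(** The slope is the supremum of the slopes from (m0, V) to points of [D] on
    its right.  Each of those is at most the slope from any point on the left,
    since otherwise the segment joining the two points would cross abscissa m0
    above V. *)
Lemma supporting_line (R : realType) (D : R -> R -> Prop) (m0 V : R)
    (convD : forall t m v m' v', 0 <= t <= 1 -> D m v -> D m' v' ->
      D (t * m + (1 - t) * m') (t * v + (1 - t) * v'))
    (left_of : exists m v, m < m0 /\ D m v)
    (right_of : exists m v, m0 < m /\ D m v)
    (maxV : forall v, D m0 v -> v <= V) :
  exists tau, forall m v, D m v -> v <= V + tau * (m - m0).
Proof.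
pose slopes : set R := fun r => exists m v, [/\ m0 < m, D m v & r = (v - V) / (m - m0)].
have slope_le m v m' v' : m < m0 -> D m v -> m0 < m' -> D m' v' ->
    (v' - V) / (m' - m0) <= (V - v) / (m0 - m).
  move=> ltm Dmv ltm' Dmv'.
  have d_gt0 : 0 < m' - m by lra.
  (* The segment from (m, v) to (m', v') crosses abscissa m0 at parameter t. *)
  pose t := (m0 - m) / (m' - m).
  have tE : t * (m' - m) = m0 - m by rewrite /t divfK // gt_eqF.
  have t01 : 0 <= t <= 1.
    by rewrite /t divr_ge0 ?ler_pdivrMr //=; lra.
  have := convD _ _ _ _ _ t01 Dmv' Dmv.
  have -> : t * m' + (1 - t) * m = m0 by rewrite -[RHS](subrK m) -tE; ring.
  move=> /maxV le_V.
  rewrite ler_pdivrMr ?subr_gt0 // mulrAC ler_pdivlMr ?subr_gt0 //.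
  have := ler_wpM2r (ltW d_gt0) le_V.
  rewrite (_ : _ * (m' - m) = t * (m' - m) * v' + ((m' - m) - t * (m' - m)) * v);
    last by ring.
  rewrite tE; lra.
have [ml [vl [ltml Dl]]] := left_of; have [mr [vr [ltmr Dr]]] := right_of.
have slopes0 : (slopes !=set0)%classic.
  by exists ((vr - V) / (mr - m0)), mr, vr.
have slopes_ub : has_ubound slopes.
  exists ((V - vl) / (m0 - ml)) => _ [m [v [ltm Dmv ->]]].
  exact: slope_le.
exists (sup slopes) => m v Dmv; rewrite -lerBlDl.
case: (ltgtP m m0) => [ltm|gtm|eqm].
- rewrite -lerN2 -mulrN !opprB -ler_pdivlMr ?subr_gt0 //.
  apply: ge_sup => // _ [m' [v' [ltm' Dmv' ->]]].
  exact: slope_le.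
- rewrite -ler_pdivrMr ?subr_gt0 //.
  by apply: ub_le_sup => //; exists m, v.
- by rewrite eqm subrr mulr0 subr_le0; apply: maxV; rewrite -eqm.
Qed.

Lemma continuous_linear_form (R : realType) (T : finType) (a : T -> R) :
  continuous (fun x : {ptws T -> R} => \sum_t x t * a t).
Proof.
pose F r (x : {ptws T -> R}) : R := \sum_(t <- r) x t * a t.
suff contF r : continuous (F r) by exact: contF.
elim: r => [|t r IHr].
  have -> : F [::] = fun=> 0 by apply: funext => x; rewrite /F big_nil.
  exact: cst_continuous.
have -> : F (t :: r) = ((fun x => x t) \* (fun=> a t)) \+ F r.
  by apply: funext => x; rewrite /F big_cons.
move=> x; apply: (@continuousD _ R^o _ (_ \* _)); last exact: IHr.
apply: continuousM; last exact: cst_continuous.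
exact: (@proj_continuous T (fun=> R) t).
Qed.

Definition simplex_polytope (R : realType) (T J : finType) (a : J -> T -> R)
    (b : J -> R) (C : J -> Prop) (x : {ffun T -> R}) : Prop :=
  [/\ forall t, 0 <= x t, \sum_t x t = 1
     & forall j, C j -> \sum_t x t * a j t <= b j].

(** The predicate [C] selects the constraints that are imposed, so that the
    constraints can be indexed by all queues while only the empty ones count.
    Compactness is that of a closed subset of a cube, in the product topology
    on plain functions. *)
Lemma polytope_max (R : realType) (T J : finType) (w : T -> R) (a : J -> T -> R)
    (b : J -> R) (C : J -> Prop) :
  (exists x, simplex_polytope R T J a b C x) ->
  exists x, simplex_polytope R T J a b C x /\
    forall y, simplex_polytope R T J a b C y ->
      \sum_t y t * w t <= \sum_t x t * w t.
Proof.
set P := simplex_polytope _ _ _ _ _ _ => -[x0 Px0].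
pose K : set {ptws T -> R} := [set f | forall t, `[0, 1]%classic (f t)]%classic.
(* The factor 1 makes the total mass a linear form with constant coefficients. *)
pose S : set {ptws T -> R} := ((fun f : {ptws T -> R} => \sum_t f t * 1) @^-1` [set x | x = 1])%classic.
pose B : set {ptws T -> R} :=
  (\bigcap_(j in C) ((fun f : {ptws T -> R} => \sum_t f t * a j t) @^-1` [set x | x <= b j]))%classic.
have cA : compact (K `&` S `&` B)%classic.
  apply: compact_closedI; first apply: compact_closedI.
  - apply: (@tychonoff T (fun=> R) (fun=> `[0, 1]%classic)) => _.
    exact: segment_compact.
  - apply: preimage_closed; last exact: closed_eq.
    by move=> f _; exact: continuous_linear_form.
  - apply: closed_bigI => j _; apply: preimage_closed; last exact: closed_le.
    by move=> f _; exact: continuous_linear_form.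
have toA x : P x -> (K `&` S `&` B)%classic (x : {ptws T -> R}).
  move=> [x0' x1 xb]; split; first split.
  - move=> t /=; rewrite in_itv /= x0' /= -x1 (bigD1 t) //= lerDl.
    by apply: sumr_ge0.
  - by rewrite /S /=; under eq_bigr do rewrite mulr1.
  - by move=> j Cj; exact: xb.
have A0 : (K `&` S `&` B !=set0)%classic by exists x0; exact: toA.
have cw : {within (K `&` S `&` B)%classic,
    continuous (fun f : {ptws T -> R} => \sum_t f t * w t)}%classic.
  by apply: continuous_subspaceT; exact: continuous_linear_form.
have [f /set_mem [[Kf Sf] Bf] fmax] := compact_EVT_max A0 cA cw.
exists [ffun t => f t]; split; first split.
- by move=> t; rewrite ffunE; have := Kf t; rewrite /= in_itv /= => /andP[].
- rewrite -Sf; apply: eq_bigr => t _; by rewrite ffunE mulr1.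
- move=> j Cj; under eq_bigr do rewrite ffunE; exact: Bf.
- move=> y Py; under [leRHS]eq_bigr do rewrite ffunE.
  by apply: fmax; apply/mem_set/toA.
Qed.

(** * Admissible measures on schedules *)

Section Schedules.

Variables (R : realType) (n : nat) (c lambda q : {ffun queue n -> R}).

Implicit Types mu : {ffun basic n -> R}.

(** The feasible set that remains when the total mass is left free. *)
Definition admissible_measure mu : Prop :=
  (forall s, 0 <= mu s) /\ admissible lambda q mu.

Lemma incidence_ge0 (s : basic n) rho : 0 <= incidence R s rho.
Proof. exact: ler0n. Qed.

Lemma admissible_measureS mu mu' :
  admissible_measure mu -> (forall s, 0 <= mu' s <= mu s) ->
  admissible_measure mu'.
Proof.
move=> [mu0 mu_adm] le_mu; split=> [s|rho q0]; first by have /andP[] := le_mu s.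
apply: le_trans (mu_adm rho q0); apply: ler_sum => s _.
by rewrite ler_wpM2r ?incidence_ge0 //; have /andP[] := le_mu s.
Qed.

Lemma sum_combination (t u : R) mu mu' (f : basic n -> R) :
  \sum_s [ffun s => t * mu s + u * mu' s] s * f s =
  t * (\sum_s mu s * f s) + u * (\sum_s mu' s * f s).
Proof.
rewrite !mulr_sumr -big_split /=; apply: eq_bigr => s _.
by rewrite ffunE mulrDl !mulrA.
Qed.

Lemma admissible_measure_convex (t : R) mu mu' :
  0 <= t <= 1 -> admissible_measure mu -> admissible_measure mu' ->
  admissible_measure [ffun s => t * mu s + (1 - t) * mu' s].
Proof.
move=> /andP[t0 t1] [mu0 mu_adm] [mu'0 mu'_adm].
have u0 : 0 <= 1 - t by rewrite subr_ge0.
split=> [s|rho q0]; first by rewrite ffunE addr_ge0 // mulr_ge0.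
rewrite /load sum_combination.
have -> : lambda rho = t * lambda rho + (1 - t) * lambda rho by ring.
by apply: lerD; apply: ler_wpM2l => //; [exact: mu_adm|exact: mu'_adm].
Qed.

Lemma zero_is_basic : is_basic [ffun _ : queue n => false].
Proof.
by apply/andP; split; apply/forallP => i; rewrite big1 // => k _; rewrite ffunE.
Qed.

Definition idle : basic n := Sub [ffun _ : queue n => false] zero_is_basic.

Definition idle_mass : {ffun basic n -> R} := [ffun s => (s == idle)%:R].

Lemma incidence_idle rho : incidence R idle rho = 0.
Proof. by rewrite /incidence /= ffunE. Qed.

Lemma weight_idle : weight c idle = 0.
Proof. by rewrite /weight big1 // => rho; rewrite /= ffunE. Qed.

Lemma sum_idle_mass (f : basic n -> R) : \sum_s idle_mass s * f s = f idle.
Proof.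
rewrite (bigD1 idle) //= ffunE eqxx mul1r big1 ?addr0 // => s /negPf ne_s.
by rewrite ffunE ne_s mul0r.
Qed.

(** The coefficients 1 are kept so that [sum_combination] computes the sums
    over this measure. *)
Lemma admissible_measure_add_idle mu :
  admissible_measure mu ->
  admissible_measure [ffun s => 1 * mu s + 1 * idle_mass s].
Proof.
move=> [mu0 mu_adm]; split=> [s|rho q0].
  by rewrite !ffunE addr_ge0 // mulr_ge0 // ler0n.
by rewrite /load sum_combination sum_idle_mass incidence_idle mulr0 addr0 mul1r mu_adm.
Qed.

(** * The program on heavy schedules *)

Lemma sum_extend (tau : R) (nu : {ffun heavy c tau -> R}) (f : basic n -> R) :
  \sum_s extend nu s * f s = \sum_s nu s * f (val s).
Proof.
rewrite (bigID (fun s => tau <= weight c s)) /= [X in _ + X]big1 ?addr0.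
  rewrite (big_sub (fun s => tau <= weight c s)).
  by apply: eq_bigr => s _; rewrite /extend ffunE valK.
by move=> s light; rewrite /extend ffunE insubN // mul0r.
Qed.

Lemma objective_extend (tau : R) (nu : {ffun heavy c tau -> R}) :
  objective nu = \sum_s extend nu s * (weight c s - tau).
Proof. by rewrite sum_extend; apply: eq_bigr => s _; rewrite mulrC. Qed.

Lemma extend_feasible (tau : R) (nu : {ffun heavy c tau -> R}) :
  feasible lambda q nu <-> admissible_measure (extend nu).
Proof.
split=> [[nu_adm nu0]|[nu0 nu_adm]].
  split=> [s|rho /eqP q0]; first by rewrite ffunE; case: insubP.
  by rewrite /load sum_extend; exact: (nu_adm (Sub rho q0)).
split=> [rho|s]; last by have := nu0 (val s); rewrite ffunE valK.
rewrite -(sum_extend _ nu (fun s => incidence R s (val rho))).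
by apply: nu_adm; apply/eqP; exact: (valP rho).
Qed.

(** * The Lagrange multiplier of the total mass *)

(** Here [mu] is a heaviest admissible schedule and [tau] the slope of a line
    supporting, at mass 1, the set of pairs (mass, weight). The zero measure
    provides a point of mass less than 1, and adding the unit mass at [idle] to
    [mu] a point of mass 2 with the same weight; the latter also forces
    [tau >= 0]. *)
Lemma critical_multiplier (lambda_ge0 : forall rho, 0 <= lambda rho) :
  exists (tau : R) mu,
    [/\ 0 <= tau, admissible_measure mu, \sum_s mu s = 1
      & forall mu', admissible_measure mu' ->
          \sum_s mu' s * (weight c s - tau) <= \sum_s mu s * (weight c s - tau)].
Proof.
have idle_adm : admissible_measure idle_mass.
  split=> [s|rho _]; first by rewrite ffunE ler0n.
  by rewrite /load sum_idle_mass incidence_idle.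
have sum1 mu : \sum_s mu s * 1 = \sum_s mu s by apply: eq_bigr => s _; rewrite mulr1.
have [|mu [[mu0 mu1 mu_adm] mu_max]] := @polytope_max R _ _ (weight c)
    (fun rho s => incidence R s rho) lambda (fun rho => q rho = 0).
  exists idle_mass; split; [exact: idle_adm.1|by rewrite -sum1 sum_idle_mass|].
  exact: idle_adm.2.
have mu_meas : admissible_measure mu by [].
pose V := \sum_s mu s * weight c s.
pose D m v := exists mu', [/\ admissible_measure mu', \sum_s mu' s = m
  & \sum_s mu' s * weight c s = v].
have D_idle : D 2 V.
  exists [ffun s => 1 * mu s + 1 * idle_mass s]; split.
  - exact: admissible_measure_add_idle.
  - by rewrite -sum1 sum_combination sum_idle_mass sum1 mu1 !mul1r.
  - by rewrite sum_combination sum_idle_mass weight_idle mulr0 addr0 mul1r.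
have [] := @supporting_line R D 1 V.
- move=> t _ _ _ _ t01 [x [xadm <- <-]] [y [yadm <- <-]].
  exists [ffun s => t * x s + (1 - t) * y s].
  split; [exact: admissible_measure_convex| |exact: sum_combination].
  by rewrite -sum1 sum_combination !sum1.
- exists 0, 0; split; first exact: ltr01.
  exists [ffun=> 0]; split.
  + apply: admissible_measureS mu_meas _ => s.
    by rewrite ffunE lexx mu0.
  + by rewrite big1 // => s _; rewrite ffunE.
  + by rewrite big1 // => s _; rewrite ffunE mul0r.
- by exists 2, V; split=> //; lra.
- by move=> _ [x [[x0 xadm] x1 <-]]; apply: mu_max.
move=> tau tauP; exists tau, mu; split=> //.
  by have := tauP _ _ D_idle; lra.
move=> mu' mu'_adm.
have split_sum (x : {ffun basic n -> R}) : \sum_s x s * (weight c s - tau) =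
    \sum_s x s * weight c s - tau * \sum_s x s.
  by rewrite mulr_sumr -sumrB; apply: eq_bigr => s _; ring.
rewrite !split_sum mu1 -/V.
have : D (\sum_s mu' s) (\sum_s mu' s * weight c s) by exists mu'.
by move=> /tauP; lra.
Qed.

(** Erasing a positive mass on a schedule of weight below [tau] would increase the
    total of [weight - tau]. *)
Lemma maximizer_support (tau : R) mu :
  admissible_measure mu ->
  (forall mu', admissible_measure mu' ->
    \sum_s mu' s * (weight c s - tau) <= \sum_s mu s * (weight c s - tau)) ->
  forall s, weight c s < tau -> mu s = 0.
Proof.
move=> mu_meas mu_max s light; have mu0 := mu_meas.1.
pose mu' : {ffun basic n -> R} := [ffun s' => if s' == s then 0 else mu s'].
have mu'_meas : admissible_measure mu'.
  apply: admissible_measureS mu_meas _ => s'.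
  by rewrite ffunE; case: ifP => _; rewrite ?lexx mu0.
have := mu_max _ mu'_meas.
rewrite (bigD1 s) //= [leRHS](bigD1 s) //= ffunE eqxx mul0r add0r.
rewrite (eq_bigr (fun s' => mu s' * (weight c s' - tau))); last first.
  by move=> s' /negPf ne_s; rewrite ffunE ne_s.
rewrite lerDr nmulr_lge0 ?subr_lt0 // => mu_le0.
by apply/eqP; rewrite eq_le mu_le0 mu0.
Qed.

End Schedules.

Theorem theorem3p1 (R : realType) (n : nat) (c lambda : {ffun queue n -> R})
    (n_ge1 : (1 <= n)%N)
    (c_gt0 : forall rho, 0 < c rho)
    (lambda01 : forall rho, 0 <= lambda rho <= 1)
    (q : {ffun queue n -> R}) (q_ge0 : forall rho, 0 <= q rho) :
  exists tau : R,
    [/\ 0 <= tau,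
        (exists s : basic n, tau <= weight c s)
      & exists nu : {ffun heavy c tau -> R},
          [/\ optimal lambda q nu,
              schedule (extend nu),
              admissible lambda q (extend nu)
            & norm1 nu = 1]].
Proof.
have lambda_ge0 rho : 0 <= lambda rho by have /andP[] := lambda01 rho.
have [tau [mu [tau0 mu_meas mu1 mu_max]]] :=
  @critical_multiplier R n c lambda q lambda_ge0.
have mu0 := mu_meas.1.
have mu_light := @maximizer_support R n c lambda q tau mu mu_meas mu_max.
pose nu : {ffun heavy c tau -> R} := [ffun s => mu (val s)].
have nuE : extend nu = mu.
  apply/ffunP => s; rewrite ffunE; case: insubP => [t _ <-|]; first by rewrite ffunE.
  by rewrite -ltNge => /mu_light ->.
have norm_mu : norm1 mu = 1.
  by rewrite -mu1; apply: eq_bigr => s _; rewrite ger0_norm.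
exists tau; split=> //.
  (* Otherwise all schedules are light and mu, of mass 1, would vanish. *)
  apply: contrapT => no_heavy.
  have : \sum_s mu s = 0.
    apply: big1 => s _; apply: mu_light; rewrite ltNge; apply/negP => heavy_s.
    by apply: no_heavy; exists s.
  by rewrite mu1 => /eqP; rewrite oner_eq0.
exists nu; split.
- split; first by apply/extend_feasible; rewrite nuE.
  by move=> nu' /extend_feasible feas; rewrite !objective_extend nuE; exact: mu_max.
- rewrite nuE; split=> // s; rewrite mu0 /= -mu1 (bigD1 s) //= lerDl.
  exact: sumr_ge0.
- by rewrite nuE; exact: mu_meas.2.
- have sum1 (T : finType) (x : {ffun T -> R}) : (forall t, 0 <= x t) ->
      norm1 x = \sum_t x t * 1.
    by move=> x0; apply: eq_bigr => t _; rewrite ger0_norm ?mulr1.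
  rewrite sum1; last by move=> s; rewrite ffunE.
  by rewrite -(sum_extend _ _ _ _ _ (fun=> 1)) nuE -sum1.
Qed.
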